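(* Let $d : p \to_{\beta_f}^* q$ be a normalising evaluation in the split fireball calculus (i.e. $q$ is a normal program). Then there exist a type context $\Gamma$, a multi type $M$ and a type derivation $\pi \triangleright \Gamma \vdash p : M$, and it satisfies $|d| + |q| \leq |\pi|$.
   Context: Terms: $t,u ::= x \mid \lambda x.t \mid tu$, up to $\alpha$-equivalence; $t\{x\leftarrow u\}$ is capture-avoiding substitution. Values: $v ::= x \mid \lambda x.t$. Fireballs $f$ and inert terms $i$ are defined by mutual induction: $f ::= v \mid i$ and $i ::= x f_1 \dots f_n$ with $n>0$ (application left-associative). Right evaluation contexts: $C ::= \langle\cdot\rangle \mid t\,C \mid C\,f$. Split fireball calculus: environments $E ::= \epsilon \mid [x\leftarrow i]:E$; programs are pairs $p=(t,E)$. Reduction on programs: $(C\langle(\lambda x.t)v\rangle,E)\to_{\beta_v}(C\langle t\{x\leftarrow v\}\rangle,E)$ and $(C\langle(\lambda x.t)i\rangle,E)\to_{\beta_i}(C\langle t\rangle,[x\leftarrow i]:E)$; $\to_{\beta_f}=\to_{\beta_v}\cup\to_{\beta_i}$. A program is normal if it has no $\to_{\beta_f}$-reduct. For an evaluation $d$, $|d|$ is its number of steps. Append: $\epsilon@[x\leftarrow i]=[x\leftarrow i]$, $([y\leftarrow i']:E)@[x\leftarrow i]=[y\leftarrow i']:(E@[x\leftarrow i])$. Sizes: $|v|=0$, $|tu|=|t|+|u|+1$, $|(t,\epsilon)|=|t|$, $|(t,E@[x\leftarrow i])|=|(t,E)|+|i|$. Multi types: linear types $L ::= M\multimap N$; multi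 types $M,N ::= [L_1,\dots,L_n]$ (finite multisets, $n\ge 0$); $\mathbf 0$ is the empty multiset, $\uplus$ multiset sum. A type context $\Gamma$ is a total map from variables to multi types with finite $\mathrm{dom}(\Gamma)=\{x\mid \Gamma(x)\ne\mathbf 0\}$; $(\Gamma\uplus\Delta)(x)=\Gamma(x)\uplus\Delta(x)$; $x:M$ maps $x$ to $M$ and all else to $\mathbf 0$; $\Gamma,x:M$ extends $\Gamma$ (with $x\notin\mathrm{dom}(\Gamma)$) by $x\mapsto M$. Typing rules: (ax) $x:M\vdash x:M$; (@) from $\Gamma\vdash t:[M\multimap N]$ and $\Delta\vdash u:M$ infer $\Gamma\uplus\Delta\vdash tu:N$; ($\lambda$) from $\Gamma_k,x:M_k\vdash t:N_k$ for $k=1,\dots,n$ ($n\ge0$) infer $\Gamma_1\uplus\dots\uplus\Gamma_n\vdash\lambda x.t:[M_1\multimap N_1,\dots,M_n\multimap N_n]$; (es$_\epsilon$) from $\Gamma\vdash t:M$ infer $\Gamma\vdash (t,\epsilon):M$; (es$_@$) from $\Gamma,x:M\vdash(t,E):N$ and $\Delta\vdash i:M$ infer $\Gamma\uplus\Delta\vdash(t,E@[x\leftarrow i]):N$. $|\pi|$ is the number of (@) rules in a derivation $\pi$. *)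

(* Defs.v *)
(* Terms are taken up to alpha-equivalence by using de Bruijn indices: a
   variable is a natural number, and the free variables of a term, and of a
   program, are named by the natural numbers. *)
From Stdlib Require List.
From HB Require Import structures.
From mathcomp Require Import all_boot.
From mathcomp Require Import finmap multiset.

Set Implicit Arguments.
Unset Strict Implicit.
Unset Printing Implicit Defensive.

Local Open Scope mset_scope.
Local Open Scope nat_scope.

Inductive term : Type :=
| Var of nat
| Lam of term
| App of term & term.

Definition up_ren (r : nat -> nat) (n : nat) : nat :=
  if n is m.+1 then (r m).+1 else 0.

Fixpoint rename (r : nat -> nat) (t : term) : term :=
  match t with
  | Var n => Var (r n)
  | Lam t => Lam (rename (up_ren r) t)
  | App t u => App (rename r t) (rename r u)
  end.

Definition up_sub (s : nat -> term) (n : nat) : term :=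
  if n is m.+1 then rename succn (s m) else Var 0.

Fixpoint subst (s : nat -> term) (t : term) : term :=
  match t with
  | Var n => s n
  | Lam t => Lam (subst (up_sub s) t)
  | App t u => App (subst s t) (subst s u)
  end.

(* [beta t u] is t{x <- u}, where x is index 0 of [t], the variable bound by
   the abstraction in the redex (\x.t)u. *)
Definition beta (t u : term) : term :=
  subst (fun n => if n is m.+1 then Var m else u) t.

Inductive value : term -> Prop :=
| ValVar n : value (Var n)
| ValLam t : value (Lam t).

Inductive fireball : term -> Prop :=
| FbValue v : value v -> fireball v
| FbInert i : inert i -> fireball i
with inert : term -> Prop :=
(* x f_1 ... f_n with n > 0 *)
| InertApp x f fs :
    fireball f -> List.Forall fireball fs ->
    inert (foldl App (Var x) (f :: fs)).

Inductive ctx : Type :=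
| Hole
| CAppR of term & ctx
| CAppL of ctx & term.

Fixpoint right_ctx (C : ctx) : Prop :=
  match C with
  | Hole => True
  | CAppR _ C => right_ctx C
  | CAppL C f => right_ctx C /\ fireball f
  end.

(* No context goes under an abstraction, so filling the hole never captures. *)
Fixpoint fill (C : ctx) (t : term) : term :=
  match C with
  | Hole => t
  | CAppR u C => App u (fill C t)
  | CAppL C f => App (fill C t) f
  end.

Fixpoint ctx_shift (C : ctx) : ctx :=
  match C with
  | Hole => Hole
  | CAppR u C => CAppR (rename succn u) (ctx_shift C)
  | CAppL C f => CAppL (ctx_shift C) (rename succn f)
  end.

Record inert_term : Type := InertTerm {
  iterm :> term;
  iterm_inert : inert iterm
}.

Definition env : Type := seq inert_term.

(* In (t, [x_0 <- i_0] : ... : [x_n <- i_n]) the variable x_k is bound in t and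
   in i_0, ..., i_(k-1), and not in i_k, i_(k+1), ...  Hence, in t, index k is
   x_k for k <= n, and index n.+1 + m is the free variable m of the program; in
   i_j, index k is x_(j+1+k) for j+1+k <= n, and index n - j + m is the free
   variable m of the program. *)
Definition program : Type := (term * env)%type.

(* In [StepInert] the entry [x <- i] is put in front of [E], so that x becomes
   index 0 in the term part of the program: [t], where the abstracted variable
   is already index 0, is unchanged, while the free variables of the context
   are shifted (x is not free in it).  Neither [i] nor [E] is in the scope of
   the new entry. *)
Inductive step : program -> program -> Prop :=
| StepValue C t v E :
    right_ctx C -> value v ->
    step (fill C (App (Lam t) v), E) (fill C (beta t v), E)
| StepInert C t (i : inert_term) E :
    right_ctx C ->
    step (fill C (App (Lam t) i), E) (fill (ctx_shift C) t, i :: E).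

Definition normal (p : program) : Prop := forall q, ~ step p q.

Inductive evaluation : program -> program -> Type :=
| EvalNil p : evaluation p p
| EvalCons p q r : step p q -> evaluation q r -> evaluation p r.

Fixpoint eval_length p q (d : evaluation p q) : nat :=
  match d with
  | EvalNil _ => 0
  | EvalCons _ _ _ _ d => (eval_length d).+1
  end.

Fixpoint term_size (t : term) : nat :=
  if t is App t u then term_size t + term_size u + 1 else 0.

Definition program_size (p : program) : nat :=
  term_size p.1 + \sum_(i <- p.2) term_size (iterm i).

(* Linear types L ::= M -o N, where M and N are finite multisets of linear
   types.  [raw] has finite sequences in place of finite multisets; a linear
   type is represented by the raw type in which all sequences are sorted for a
   fixed total order.  The multi types are then the finite multisets of linear
   types; [arrow_inj], [arrow_surj] and [ltype_ind] state that the linear types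
   are freely generated by [arrow]. *)
Inductive raw : Type := Raw of seq raw & seq raw.

Lemma raw_nested_ind (P : raw -> Prop) :
  (forall s t, List.Forall P s -> List.Forall P t -> P (Raw s t)) ->
  forall r, P r.
Proof.
move=> IH; fix raw_nested_ind 1 => -[s t]; apply: IH.
  by elim: s => [|r s IHs]; constructor.
by elim: t => [|r t IHt]; constructor.
Qed.

Fixpoint raw_encode (r : raw) : GenTree.tree void :=
  let: Raw s t := r in
  GenTree.Node 0 [:: GenTree.Node 0 (map raw_encode s);
                     GenTree.Node 0 (map raw_encode t)].

Fixpoint raw_decode (r : GenTree.tree void) : raw :=
  match r with
  | GenTree.Node _ [:: GenTree.Node _ s; GenTree.Node _ t] =>
      Raw (map raw_decode s) (map raw_decode t)
  | _ => Raw [::] [::]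
  end.

Lemma raw_encodeK : cancel raw_encode raw_decode.
Proof.
elim/raw_nested_ind => s t IHs IHt /=; congr Raw.
  by elim: IHs => //= r s' -> _ ->.
by elim: IHt => //= r s' -> _ ->.
Qed.

HB.instance Definition _ := Countable.copy raw (can_type raw_encodeK).

Definition raw_le : rel raw := fun r1 r2 => (choice.pickle r1 <= choice.pickle r2)%N.

Lemma raw_le_total : total raw_le.
Proof. by move=> r1 r2; apply: leq_total. Qed.

Lemma raw_le_trans : transitive raw_le.
Proof. by move=> r2 r1 r3; apply: leq_trans. Qed.

Lemma raw_le_anti : antisymmetric raw_le.
Proof.
by move=> r1 r2; rewrite -eqn_leq => /eqP; apply: (pcan_inj choice.pickleK).
Qed.

Fixpoint canonical (r : raw) : bool :=
  let: Raw s t := r in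
  [&& sorted raw_le s, all canonical s, sorted raw_le t & all canonical t].

Record ltype : Type := LType { lraw : raw; lraw_canonical : canonical lraw }.

HB.instance Definition _ := [isSub for lraw].
HB.instance Definition _ := [Choice of ltype by <:].

Notation mtype := {mset ltype}.

Definition mraw (M : mtype) : seq raw := sort raw_le (map lraw (enum_mset M)).

Lemma mraw_canonical (M : mtype) : sorted raw_le (mraw M) && all canonical (mraw M).
Proof.
rewrite sort_sorted /=; last exact: raw_le_total.
by rewrite all_sort; apply/allP => _ /mapP[L _ ->]; apply: lraw_canonical.
Qed.

Lemma arrow_canonical (M N : mtype) : canonical (Raw (mraw M) (mraw N)).
Proof.
by have /andP[sM cM] := mraw_canonical M; have /andP[sN cN] := mraw_canonical N;
  apply/and4P.
Qed.

Definition arrow (M N : mtype) : ltype := LType (arrow_canonical M N).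

Lemma mraw_inj : injective mraw.
Proof.
move=> M N /(perm_sortP raw_le_total raw_le_trans raw_le_anti) pMN.
rewrite -[M]seq_mset_id -[N]seq_mset_id; apply/eq_seq_msetP.
by apply: perm_map_inj pMN; apply: val_inj.
Qed.

Lemma arrow_inj M N M' N' : arrow M N = arrow M' N' -> M = M' /\ N = N'.
Proof. by case=> /mraw_inj -> /mraw_inj ->. Qed.

Lemma mraw_surj (s : seq raw) :
  sorted raw_le s -> all canonical s -> exists M : mtype, mraw M = s.
Proof.
move=> ss cs.
have [l sE] : exists l : seq ltype, s = map lraw l.
  elim: s cs {ss} => [|r s IHs] /=; first by exists [::].
  by case/andP=> cr /IHs[l ->]; exists (LType cr :: l).
exists (seq_mset l); rewrite -[RHS](sorted_sort raw_le_trans ss) sE.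
  apply/(perm_sortP raw_le_total raw_le_trans raw_le_anti)/perm_map.
  exact: perm_eq_seq_mset.
Qed.

Lemma arrow_surj (L : ltype) : exists M N, L = arrow M N.
Proof.
case: L => -[s t] /= c; have /and4P[/mraw_surj sP cs /mraw_surj tP ct] := c.
have [M Ms] := sP cs; have [N Nt] := tP ct.
by exists M, N; apply: val_inj; rewrite /= Ms Nt.
Qed.

Lemma mem_mraw (M : mtype) L : L \in M -> lraw L \in mraw M.
Proof. by move=> LM; rewrite mem_sort map_f. Qed.

Lemma ltype_ind (P : ltype -> Prop) :
  (forall M N : mtype, (forall L, L \in M -> P L) ->
     (forall L, L \in N -> P L) -> P (arrow M N)) ->
  forall L, P L.
Proof.
move=> IH L; move: {2}(lraw L) (erefl (lraw L)) => r.
elim/raw_nested_ind: r L => s t IHs IHt L.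
have inF (A : seq raw) (Q : raw -> Prop) x : List.Forall Q A -> x \in A -> Q x.
  by elim=> // a A' Qa _ IHA; rewrite inE => /predU1P[->|/IHA].
have [M [N ->]] := arrow_surj L => -[sE tE].
apply: IH => L' /mem_mraw; rewrite ?sE ?tE.
  by move=> /(inF _ _ _ IHs)/(_ L'); apply.
by move=> /(inF _ _ _ IHt)/(_ L'); apply.
Qed.

Definition tctx : Type := {fsfun nat -> mtype with mset0}.

Definition tctx0 : tctx := [fsfun].

Definition tctxD (G D : tctx) : tctx :=
  [fsfun x in (finsupp G `|` finsupp D)%fset => G x `+` D x].

Definition tctx1 (x : nat) (M : mtype) : tctx := [fsfun tctx0 with x |-> M].

(* The context G, x : M, where x becomes index 0 and the variables of [G] are
   shifted; x is thus never in the domain of [G]. *)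
Definition tctx_cons (G : tctx) (M : mtype) : tctx :=
  [fsfun x in (0 |` [fset y.+1 | y in finsupp G])%fset =>
     if x is y.+1 then G y else M].

Lemma tctx0E x : tctx0 x = mset0.
Proof. by rewrite fsfun0E. Qed.

Lemma tctxDE G D x : tctxD G D x = G x `+` D x.
Proof.
rewrite fsfunE inE; case: (finsuppP G x) => //= _.
by case: (finsuppP D x) => //= _; rewrite msetD0.
Qed.

Lemma tctx1E x M y : tctx1 x M y = if y == x then M else mset0.
Proof. by rewrite fsfun_withE tctx0E. Qed.

Lemma tctx_consE G M x : tctx_cons G M x = if x is y.+1 then G y else M.
Proof.
rewrite fsfunE; case: x => [|y]; rewrite !inE //=.
case: ifP => // /negbT yG; rewrite fsfun_dflt //.
by apply: contra yG => yG; apply/imfsetP; exists y.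
Qed.

Inductive tderiv : tctx -> term -> mtype -> Type :=
| TAx x M : tderiv (tctx1 x M) (Var x) M
| TApp G D t u M N :
    tderiv G t [mset (arrow M N)] -> tderiv D u M ->
    tderiv (tctxD G D) (App t u) N
| TLam n (G : 'I_n -> tctx) (M N : 'I_n -> mtype) t :
    (forall k, tderiv (tctx_cons (G k) (M k)) t (N k)) ->
    tderiv (\big[tctxD/tctx0]_(k < n) G k) (Lam t)
      (seq_mset [seq arrow (M k) (N k) | k <- enum 'I_n]).

(* In (t, E@[x <- i]) the variable x is bound in the program (t, E), of which it
   is the free variable 0. *)
Inductive ptderiv : tctx -> program -> mtype -> Type :=
| TEsNil G t M : tderiv G t M -> ptderiv G (t, [::]) M
| TEsRcons G D t E (i : inert_term) M N :
    ptderiv (tctx_cons G M) (t, E) N -> tderiv D i M ->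
    ptderiv (tctxD G D) (t, rcons E i) N.

Fixpoint tderiv_size G t M (pi : tderiv G t M) : nat :=
  match pi with
  | TAx _ _ => 0
  | TApp _ _ _ _ _ _ pi1 pi2 => (tderiv_size pi1 + tderiv_size pi2).+1
  | TLam _ _ _ _ _ pis => \sum_k tderiv_size (pis k)
  end.

Fixpoint ptderiv_size G p M (pi : ptderiv G p M) : nat :=
  match pi with
  | TEsNil _ _ _ pi => tderiv_size pi
  | TEsRcons _ _ _ _ _ _ _ pi1 pi2 => ptderiv_size pi1 + tderiv_size pi2
  end.

(* Main.v *)
(* Typability is propagated backwards along the evaluation.  A normal program
   is a fireball in an environment of inert terms; inert terms can be given
   every multi type, so normal programs are typable, with at least as many
   application rules as their size.  Each step is then undone at the cost of
   exactly one more application rule: for [StepValue] by splitting a derivation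
   of t{x <- v} into one of t and one of v, which works because derivations of
   a value can be merged; for [StepInert] by moving the type of the new
   environment entry to the argument of the redex. *)
Require Import Defs.
From mathcomp Require Import all_boot.
From mathcomp Require Import finmap multiset.

Set Implicit Arguments.
Unset Strict Implicit.
Unset Printing Implicit Defensive.

Local Open Scope mset_scope.
Local Open Scope nat_scope.

(** * Algebra of type contexts *)

Lemma tctxDC : commutative tctxD.
Proof. by move=> G D; apply/fsfunP => x; rewrite !tctxDE msetDC. Qed.

Lemma tctxDA : associative tctxD.
Proof. by move=> G D F; apply/fsfunP => x; rewrite !tctxDE msetDA. Qed.

Lemma tctx0D : left_id tctx0 tctxD.
Proof. by move=> G; apply/fsfunP => x; rewrite tctxDE tctx0E mset0D. Qed.

Lemma tctxD0 : right_id tctx0 tctxD.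
Proof. by move=> G; rewrite tctxDC tctx0D. Qed.

Lemma tctx1_mset0 x : tctx1 x mset0 = tctx0.
Proof. by apply/fsfunP => y; rewrite tctx1E tctx0E if_same. Qed.

Lemma tctx1D x M N : tctxD (tctx1 x M) (tctx1 x N) = tctx1 x (M `+` N).
Proof.
by apply/fsfunP => y; rewrite tctxDE !tctx1E; case: eqP => // _; rewrite mset0D.
Qed.

(** Undoes [tctx_cons]. Index 0 of [G] may add a spurious 0 to the listed set, where the value is
    still [G 1]. *)
Definition tctx_behead (G : tctx) : tctx :=
  [fsfun x in [fset y.-1 | y in finsupp G]%fset => G x.+1].

Lemma tctx_beheadE G x : tctx_behead G x = G x.+1.
Proof.
rewrite fsfunE; case: ifP => // /negbT xG; rewrite fsfun_dflt //.
by apply: contra xG => xG; apply/imfsetP; exists x.+1.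
Qed.

Lemma tctx_consK G : tctx_cons (tctx_behead G) (G 0) = G.
Proof. by apply/fsfunP => -[|x]; rewrite tctx_consE ?tctx_beheadE. Qed.

Lemma tctx_beheadD G D : tctx_behead (tctxD G D) = tctxD (tctx_behead G) (tctx_behead D).
Proof. by apply/fsfunP => x; rewrite !(tctxDE, tctx_beheadE). Qed.

(** * Typing with a count of application rules *)

(* [m] counts the application rules of a derivation.  The rule for abstractions
   is split into a nullary rule and a rule adding one premise, so that inductions
   need no families of derivations. *)
Inductive typed : nat -> tctx -> term -> mtype -> Prop :=
| TypedVar x M : typed 0 (tctx1 x M) (Var x) M
| TypedApp m n G D t u M N :
    typed m G t [mset (arrow M N)] -> typed n D u M ->
    typed (m + n).+1 (tctxD G D) (App t u) N
| TypedLam0 t : typed 0 tctx0 (Lam t) mset0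
| TypedLamS m n G D t M N K :
    typed m (tctx_cons G M) t N -> typed n D (Lam t) K ->
    typed (m + n) (tctxD G D) (Lam t) (arrow M N +` K).

Lemma tderiv_lam_inv G t M (pi : tderiv G (Lam t) M) :
  exists n (F : 'I_n -> tctx) (A B : 'I_n -> mtype)
    (pis : forall k, tderiv (tctx_cons (F k) (A k)) t (B k)),
    [/\ G = \big[tctxD/tctx0]_(k < n) F k,
        M = seq_mset [seq arrow (A k) (B k) | k <- enum 'I_n]
      & tderiv_size pi = \sum_k tderiv_size (pis k)].
Proof.
move: pi; move E: (Lam t) => u pi; case: pi E => // n F A B t' pis [tE].
by subst t'; exists n, F, A, B, pis.
Qed.

Lemma tderiv_lam_cons G t M N D K
    (pi : tderiv (tctx_cons G M) t N) (rho : tderiv D (Lam t) K) :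
  exists pi' : tderiv (tctxD G D) (Lam t) (arrow M N +` K),
    tderiv_size pi' = tderiv_size pi + tderiv_size rho.
Proof.
have [n [F [A [B [pis [DE KE0 ->]]]]]] := tderiv_lam_inv rho; subst D K.
(* The new premise goes at index 0: [unlift ord0] maps an index of ['I_n.+1] to [None] for the new
   premise, or to [Some k] for an old one. *)
pose F' o := oapp F G o; pose A' o := oapp A M o; pose B' o := oapp B N o.
pose pis' o : tderiv (tctx_cons (F' o) (A' o)) t (B' o) :=
  if o is Some k then pis k else pi.
have uE (k : 'I_n) : unlift ord0 (lift ord0 k) = Some k by apply: liftK.
have GE : \big[tctxD/tctx0]_(k < n.+1) F' (unlift ord0 k)
    = tctxD G (\big[tctxD/tctx0]_(k < n) F k).
  rewrite big_ord_recl unlift_none; congr tctxD.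
  by apply: eq_bigr => k _; rewrite uE.
have KE : seq_mset [seq arrow (A' (unlift ord0 k)) (B' (unlift ord0 k)) | k <- enum 'I_n.+1]
    = arrow M N +` seq_mset [seq arrow (A k) (B k) | k <- enum 'I_n].
  rewrite enum_ordSl /= unlift_none mset_cons -map_comp; congr (_ +` seq_mset _).
  by apply: eq_map => k /=; rewrite uE.
have SE : \sum_k tderiv_size (pis' (unlift ord0 k))
    = tderiv_size pi + \sum_k tderiv_size (pis k).
  rewrite big_ord_recl unlift_none; congr (_ + _).
  by apply: eq_bigr => k _; rewrite uE.
rewrite -GE -KE -SE.
by exists (TLam (fun k => pis' (unlift ord0 k))).
Qed.

Lemma typed_tderiv m G t M :
  typed m G t M -> exists pi : tderiv G t M, tderiv_size pi = m.
Proof.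
elim=> {m G t M} [x M|m n G D t u M N _ [pi <-] _ [rho <-]|t|m n G D t M N K _ [pi <-] _ [rho <-]].
- by exists (TAx x M).
- by exists (TApp pi rho).
- pose none (T : Type) (k : 'I_0) : T := False_rect T (notF (ltn_ord k)).
  have GE : \big[tctxD/tctx0]_(k < 0) none tctx k = tctx0 by rewrite big_ord0.
  have ME : seq_mset [seq arrow (none mtype k) (none mtype k) | k <- enum 'I_0] = mset0.
    by rewrite (size0nil (size_enum_ord 0)); apply/msetP => L; rewrite mset_seqE mset0E.
  rewrite -GE -ME; exists (TLam (fun k => none (tderiv _ t _) k)).
  by rewrite /= big_ord0.
- exact: tderiv_lam_cons.
Qed.

Lemma typed_var_inv m G x M : typed m G (Var x) M -> m = 0 /\ G = tctx1 x M.
Proof. by move E: (Var x) => t H; case: H E => // y N [->]. Qed.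

Lemma typed_app_inv m G t u N : typed m G (App t u) N ->
  exists m1 m2 G1 G2 M, [/\ typed m1 G1 t [mset (arrow M N)], typed m2 G2 u M,
    m = (m1 + m2).+1 & G = tctxD G1 G2].
Proof.
move E: (App t u) => s H; case: H E => // m1 m2 G1 G2 t' u' M N' H1 H2 [-> ->].
by exists m1, m2, G1, G2, M.
Qed.

Lemma typed_lam_ind t (P : nat -> tctx -> mtype -> Prop) :
  P 0 tctx0 mset0 ->
  (forall m n G D M N K, typed m (tctx_cons G M) t N -> P n D K ->
     P (m + n) (tctxD G D) (arrow M N +` K)) ->
  forall m G M, typed m G (Lam t) M -> P m G M.
Proof.
move=> P0 PS m G M; move E: (Lam t) => s H.
elim: H E => // {m G M s} m n G D s M N K H _ _ IH [tE].
by subst s; apply: PS => //; apply: IH.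
Qed.

(** * Values, renaming and substitution *)

Lemma typed_value0 v : value v -> typed 0 tctx0 v mset0.
Proof. by case=> [x|t]; [rewrite -(tctx1_mset0 x)|]; constructor. Qed.

(** Two axioms add their types, and two abstractions pool their premises; neither needs a new
    application rule. *)
Lemma typed_valueD v m n G D M N : value v ->
  typed m G v M -> typed n D v N -> typed (m + n) (tctxD G D) v (M `+` N).
Proof.
case=> [x /typed_var_inv[-> ->] /typed_var_inv[-> ->]|t H1 H2].
  by rewrite tctx1D; constructor.
elim/typed_lam_ind: H1 => [|p q F F' A B K H IH]; first by rewrite tctx0D mset0D.
by rewrite -addnA -tctxDA -msetDA; constructor.
Qed.

Lemma value_rename r v : value v -> value (rename r v).
Proof. by case=> *; constructor. Qed.

(** The last clause is what shows that a shifted term demands nothing of index 0. *)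
Lemma typed_unrename m G r t M : injective r -> typed m G (rename r t) M ->
  exists D, [/\ typed m D t M, forall x, D x = G (r x)
    & forall y, (forall x, r x <> y) -> G y = mset0].
Proof.
elim: t m G r M => [x|t IHt|t IHt u IHu] m G r M rI /=.
- case/typed_var_inv=> -> ->; exists (tctx1 x M); split; first by constructor.
    by move=> y; rewrite !tctx1E (inj_eq rI).
  by move=> y yr; rewrite tctx1E; case: eqP => // yE; case: (yr x).
- have urI : injective (up_ren r) by case=> [|x] [|y] //= [/rI->].
  elim/typed_lam_ind=> [|p q F F' A B K H [D' [D't D'E D'0]]].
    exists tctx0; split; first by constructor.
      by move=> x; rewrite !tctx0E.
    by move=> x _; rewrite tctx0E.
  have [D [Dt DE D0]] := IHt _ _ _ _ urI H.
  exists (tctxD (tctx_behead D) D'); split.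
  + constructor=> //.
    by have -> : A = D 0; [rewrite DE tctx_consE | rewrite tctx_consK].
  + by move=> x; rewrite !tctxDE tctx_beheadE DE D'E tctx_consE.
  + move=> y yr; rewrite tctxDE D'0 // msetD0.
    have := D0 y.+1; rewrite tctx_consE; apply.
    by case=> [|x] //= [/yr].
- case/typed_app_inv=> m1 [m2 [G1 [G2 [N [H1 H2 -> ->]]]]].
  have [D1 [D1t D1E D10]] := IHt _ _ _ _ rI H1.
  have [D2 [D2t D2E D20]] := IHu _ _ _ _ rI H2.
  exists (tctxD D1 D2); split; first by econstructor; eassumption.
    by move=> x; rewrite !tctxDE D1E D2E.
  by move=> y yr; rewrite tctxDE D10 // D20 // msetD0.
Qed.

Lemma typed_unshift m G t M : typed m G (rename succn t) M ->
  typed m (tctx_behead G) t M /\ G 0 = mset0.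
Proof.
case/(typed_unrename succn_inj)=> D [Dt DE D0]; split; last by rewrite D0.
by have -> : tctx_behead G = D; [apply/fsfunP => x; rewrite tctx_beheadE DE|].
Qed.

(** [bump k] enumerates the indices other than [k], and [k] is general because each abstraction
    crossed raises it. The derivations of [v] found at the occurrences of [k] are merged into
    one. *)
Lemma typed_unsubst m G s k v t M :
  value v -> s k = v -> (forall n, s (bump k n) = Var n) ->
  typed m G (subst s t) M ->
  exists m1 m2 G1 G2, [/\ typed m1 G1 t M, typed m2 G2 v (G1 k), m = m1 + m2
    & forall n, G n = G1 (bump k n) `+` G2 n].
Proof.
elim: t m G s k v M => [x|t IHt|t IHt u IHu] m G s k v M vv sk sb /=.
- have [->|/eqP xk] := x =P k.
    rewrite sk => H; exists 0, m, (tctx1 k M), G; split=> //; first by constructor.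
      by rewrite tctx1E eqxx.
    by move=> n; rewrite tctx1E eq_sym (negbTE (neq_bump _ _)) mset0D.
  have xE : x = bump k (unbump k x) by rewrite unbumpKcond (negbTE xk).
  rewrite {1}xE sb => /typed_var_inv[-> ->].
  (* Index [k] does not occur here, so [v] gets its free typing by [mset0]. *)
  exists 0, 0, (tctx1 x M), tctx0; split=> //; first by constructor.
    by rewrite tctx1E eq_sym (negbTE xk); apply: typed_value0.
  move=> n; rewrite tctx0E msetD0 !tctx1E {2}xE.
  by rewrite (can_eq (bumpK k)).
- elim/typed_lam_ind=> [|p q F F' A B K H [m1 [m2 [G1 [G2 [H1 H2 -> GE]]]]]].
    exists 0, 0, tctx0, tctx0; split=> //; first by constructor.
      by rewrite tctx0E; apply: typed_value0.
    by move=> n; rewrite !tctx0E msetD0.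
  have sk' : up_sub s k.+1 = rename succn v by rewrite /= sk.
  have sb' n : up_sub s (bump k.+1 n) = Var n.
    by case: n => [|n] //; rewrite bumpS /= sb.
  have [n1 [n2 [D1 [D2 [K1 K2 -> DE]]]]] := IHt _ _ _ _ _ _ (value_rename _ vv) sk' sb' H.
  (* The shifted [v] leaves index 0 alone, so the type of the bound variable comes from the body
     only. *)
  have [K2' D20] := typed_unshift K2.
  exists (n1 + m1), (n2 + m2), (tctxD (tctx_behead D1) G1), (tctxD (tctx_behead D2) G2).
  split.
  + constructor=> //; suff -> : A = D1 0 by rewrite tctx_consK.
    by have := DE 0; rewrite tctx_consE D20 msetD0.
  + by rewrite tctxDE tctx_beheadE; apply: typed_valueD.
  + by rewrite addnACA.
  + move=> n; have := DE n.+1; rewrite tctx_consE bumpS => FE.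
    by rewrite !tctxDE !tctx_beheadE FE GE msetDACA.
- case/typed_app_inv=> p [q [F [F' [N [H H' -> ->]]]]].
  have [m1 [m2 [G1 [G2 [H1 H2 -> GE]]]]] := IHt _ _ _ _ _ _ vv sk sb H.
  have [n1 [n2 [D1 [D2 [K1 K2 -> DE]]]]] := IHu _ _ _ _ _ _ vv sk sb H'.
  exists (m1 + n1).+1, (m2 + n2), (tctxD G1 D1), (tctxD G2 D2); split.
  + by econstructor; eassumption.
  + by rewrite tctxDE; apply: typed_valueD.
  + by rewrite addnACA.
  + by move=> n; rewrite !tctxDE GE DE msetDACA.
Qed.

(** * Undoing a step inside a term *)

Lemma typed_redex m n G D t u M N :
  typed m (tctx_cons G M) t N -> typed n D u M ->
  typed (m + n).+1 (tctxD G D) (App (Lam t) u) N.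
Proof.
move=> Ht; apply: TypedApp.
(* The abstraction has a single premise: [TypedLamS] over [TypedLam0]. *)
rewrite -[m]addn0 -[G]tctxD0 -[[mset _]]msetD0.
by constructor=> //; constructor.
Qed.

Lemma typed_beta_expansion m G t v M : value v ->
  typed m G (beta t v) M -> typed m.+1 G (App (Lam t) v) M.
Proof.
move=> vv /(typed_unsubst (k := 0) vv erefl (fun=> erefl)).
case=> m1 [m2 [G1 [G2 [H1 H2 -> GE]]]].
have -> : G = tctxD (tctx_behead G1) G2.
  by apply/fsfunP => x; rewrite GE tctxDE tctx_beheadE.
by apply: (typed_redex _ H2); rewrite tctx_consK.
Qed.

(** The hole lies under no abstraction, so it is typed exactly once and the count grows by exactly
    one. *)
Lemma typed_fill C t u :
  (forall m G M, typed m G t M -> typed m.+1 G u M) ->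
  forall m G M, typed m G (fill C t) M -> typed m.+1 G (fill C u) M.
Proof.
move=> tu; elim: C => [|s C IH|C IH s] m G M //=; first exact: tu.
  case/typed_app_inv=> p [q [F [F' [N [H /IH H' -> ->]]]]].
  by rewrite -addnS; econstructor; eassumption.
case/typed_app_inv=> p [q [F [F' [N [/IH H H' -> ->]]]]].
by rewrite -addSn; econstructor; eassumption.
Qed.

(** The shifted terms of [C] do not mention index 0, so all of [G 0] is demanded by [t]: it is the
    type that the argument of the redex must have. *)
Lemma typed_entry_expansion C t u m n G D N :
  typed m G (fill (ctx_shift C) t) N -> typed n D u (G 0) ->
  typed (m + n).+1 (tctxD (tctx_behead G) D) (fill C (App (Lam t) u)) N.
Proof.
move=> + Hu; elim: C m G N Hu => [|s C IH|C IH s] m G N Hu /=.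
- by move=> Ht; apply: (typed_redex _ Hu); rewrite tctx_consK.
- case/typed_app_inv=> p [q [F [F' [K [/typed_unshift[H F0] H' mE GE]]]]].
  move: Hu; rewrite GE tctxDE F0 mset0D => Hu.
  rewrite tctx_beheadD -tctxDA mE addSn -addnA -addnS.
  by econstructor; [eassumption | apply: IH].
- case/typed_app_inv=> p [q [F [F' [K [H /typed_unshift[H' F0] mE GE]]]]].
  move: Hu; rewrite GE tctxDE F0 msetD0 => Hu.
  rewrite tctx_beheadD -tctxDA (tctxDC (tctx_behead F')) tctxDA.
  rewrite mE addSn addnAC -addSn.
  by econstructor; [apply: IH; eassumption|].
Qed.

(** * Typing of programs *)

(* [env_typed m G E D]: typing the entries of [E] with [m] application rules
   turns a term typed in [G] into a program typed in [D]. *)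
Fixpoint env_typed (m : nat) (G : tctx) (E : env) (D : tctx) : Prop :=
  if E is i :: E' then
    exists m1 m2 F, [/\ typed m1 F i (G 0),
      env_typed m2 (tctxD (tctx_behead G) F) E' D & m = m1 + m2]
  else m = 0 /\ G = D.

(** Works through the environment from the front, where [StepInert] adds entries; [TEsRcons] treats
    the last entry instead. *)
Definition ptyped (m : nat) (D : tctx) (p : program) (M : mtype) : Prop :=
  exists m1 m2 G, [/\ typed m1 G p.1 M, env_typed m2 G p.2 D & m = m1 + m2].

Lemma env_typed_rcons m G E i D : env_typed m G (rcons E i) D ->
  exists m1 m2 F F', [/\ env_typed m1 G E F, typed m2 F' i (F 0), m = m1 + m2
    & D = tctxD (tctx_behead F) F'].
Proof.
elim: E m G => [|j E IH] m G /=.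
  move=> [m1 [m2 [F [H [-> <-] ->]]]].
  by exists 0, m1, G, F; rewrite addn0.
move=> [m1 [m2 [F [H /IH[n1 [n2 [F1 [F2 [H1 H2 -> ->]]]]] ->]]]].
exists (m1 + n1), n2, F1, F2; rewrite addnA; split=> //.
by exists m1, n1, F.
Qed.

Lemma ptyped_ptderiv m D p M :
  ptyped m D p M -> exists pi : ptderiv D p M, ptderiv_size pi = m.
Proof.
case: p => t E [m1 [m2 [G [/= /typed_tderiv[pi <-]]]]].
elim/last_ind: E m m2 D => [|E i IH] m m2 D /=.
  by move=> [-> <-] ->; exists (TEsNil pi); rewrite addn0.
case/env_typed_rcons=> n1 [n2 [F [F' [H /typed_tderiv[rho <-] -> -> ->]]]].
have [] := IH _ _ _ H erefl; rewrite -{1 2}(tctx_consK F) => pi' pi'E.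
by exists (TEsRcons pi' rho); rewrite /= pi'E addnA.
Qed.

Lemma ptyped_expansion p q m G M : step p q -> ptyped m G q M -> ptyped m.+1 G p M.
Proof.
case=> [C t v E _ vv|C t i E _] [m1 [m2 [D [/= H HE ->]]]].
  exists m1.+1, m2, D; split=> //=.
  by apply: typed_fill H => *; apply: typed_beta_expansion.
case: HE => n1 [n2 [F [Hi HE ->]]].
exists (m1 + n1).+1, n2, (tctxD (tctx_behead D) F); split=> //=.
  exact: typed_entry_expansion.
by rewrite addnA.
Qed.

(** * Fireballs and normal programs *)

(** Peeling off the last argument turns the n-ary grammar into a binary one, [x f] or [i f], which
    suits induction on terms. *)
Lemma inert_inv i : inert i -> exists t f,
  [/\ i = App t f, (exists x, t = Var x) \/ inert t & fireball f].
Proof.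
case=> x f fs ff; elim/last_ind: fs => [|fs g _].
  by exists (Var x), f; split=> //; left; exists x.
rewrite -cats1 => /List.Forall_app[ffs fg]; exists (foldl App (Var x) (f :: fs)), g.
split; first by rewrite -cat_cons foldl_cat.
  by right; constructor.
by inversion fg.
Qed.

Lemma inert_app t f : (exists x, t = Var x) \/ inert t -> fireball f -> inert (App t f).
Proof.
move=> [[x ->] ff|]; first exact: (@InertApp x f [::] ff (List.Forall_nil _)).
case=> x g fs fg ffs ff.
have -> : App (foldl App (Var x) (g :: fs)) f = foldl App (Var x) (g :: fs ++ [:: f]).
  by rewrite -cat_cons foldl_cat.
by constructor=> //; apply/List.Forall_app; split=> //; constructor.
Qed.

Lemma fireball_app t u : fireball (App t u) -> inert (App t u).
Proof. by move E: (App t u) => s H; case: H E => // v []. Qed.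

(** An inert term takes any type because its head variable does. An abstraction is typed by [mset0]
    with its body left untyped, and the size ignores that body too. *)
Lemma fireball_typed t :
  (fireball t -> exists m G, typed m G t mset0 /\ term_size t <= m) /\
  (inert t -> forall M, exists m G, typed m G t M /\ term_size t <= m).
Proof.
elim: t => [x|t _|t [_ IHt] u [IHu _]].
- split; last by case/inert_inv=> ? [? []].
  by exists 0, tctx0; split=> //; apply: typed_value0; constructor.
- split; last by case/inert_inv=> ? [? []].
  by exists 0, tctx0; split=> //; constructor.
- suff H : inert (App t u) ->
      forall M, exists m G, typed m G (App t u) M /\ term_size (App t u) <= m.
    by split=> // /fireball_app/H.
  case/inert_inv=> _ [_ [[<- <-] tP /IHu[n [D [Hu un]]]]] M.
  (* The domain [mset0] asks of the argument only what every fireball provides. *)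
  have [m [G [Ht tm]]] :
      exists m G, typed m G t [mset (arrow mset0 M)] /\ term_size t <= m.
    case: tP => [[x ->]|/IHt]; last exact.
    by exists 0, (tctx1 x [mset (arrow mset0 M)]); split=> //; constructor.
  exists (m + n).+1, (tctxD G D); split; first by econstructor; eassumption.
  by rewrite /= addn1 ltnS leq_add.
Qed.

(** The demand [G 0] on each entry is met whatever it is, since inert terms take every multi
    type. *)
Lemma env_typed_exists G E :
  exists m D, env_typed m G E D /\ \sum_(i <- E) term_size (iterm i) <= m.
Proof.
elim: E G => [|i E IH] G; first by exists 0, G; rewrite big_nil.
have [m [F [Hi im]]] := (fireball_typed i).2 (iterm_inert i) (G 0).
have [n [D [HE En]]] := IH (tctxD (tctx_behead G) F).
exists (m + n), D; split; first by exists m, n, F.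
by rewrite big_cons leq_add.
Qed.

Lemma fireball_or_redex t : fireball t \/
  exists C s f, [/\ right_ctx C, fireball f & t = fill C (App (Lam s) f)].
Proof.
elim: t => [x|t _|t IHt u [fu|[C [s [f [HC ff ->]]]]]].
- by left; do 2!constructor.
- by left; do 2!constructor.
(* Here [u] is a fireball, as a right context requires when its hole lies in [t]. *)
- case: IHt => [ft|[C [s [f [HC ff ->]]]]]; last first.
    by right; exists (CAppL C u), s, f.
  case: t / ft => [v [x|s]|i ii].
  + by left; apply/FbInert/inert_app => //; left; exists x.
  + by right; exists Hole, s, u.
  + by left; apply/FbInert/inert_app => //; right.
- by right; exists (CAppR t C), s, f.
Qed.

Lemma normal_fireball t E : normal (t, E) -> fireball t.
Proof.
move=> tN; have [//|[C [s [f [HC ff tE]]]]] := fireball_or_redex t; subst t.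
case: f / ff tN => [v vv /(_ _ (StepValue s E HC vv))//|i ii].
by move=> /(_ _ (StepInert s (InertTerm ii) E HC)).
Qed.

Lemma normal_ptyped q : normal q -> exists m G, ptyped m G q mset0 /\ program_size q <= m.
Proof.
case: q => t E /normal_fireball/(fireball_typed t).1[m [G [Ht tm]]].
have [n [D [HE En]]] := env_typed_exists G E.
by exists (m + n), D; split; [exists m, n, G | rewrite leq_add].
Qed.

(** * The bound for whole evaluations *)

Lemma evaluation_ptyped p q (d : evaluation p q) m G M :
  ptyped m G q M -> ptyped (eval_length d + m) G p M.
Proof. by elim: d => // p' q' r pq d IH /IH; apply: ptyped_expansion. Qed.

Theorem theorem3 (p q : program) (d : evaluation p q) (q_normal : normal q) :
  exists (G : tctx) (M : mtype) (pi : ptderiv G p M),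
    (eval_length d + program_size q <= ptderiv_size pi)%N.
Proof.
have [m [G [/(evaluation_ptyped d)/ptyped_ptderiv[pi piE] qm]]] := normal_ptyped q_normal.
by exists G, mset0, pi; rewrite piE leq_add2l.
Qed.
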